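(* Let $\alpha$ be a countable ordinal with $1\le\alpha<\omega_1$, and let $G$ be a $V$-generic filter for the forcing $P(\omega^\alpha)/\mathrm{fin}^{\otimes\alpha}$. Then in $V[G]$, $G$ is an ultrafilter on $\omega^\alpha$ and $(G\cdot G,\supseteq)\equiv_T(G,\supseteq)$.
   Context: Notation: $\mathrm{fin}=[\omega]^{<\omega}$. The sets $\omega^\alpha$ and ideals $\mathrm{fin}^{\otimes\alpha}$ on them ($1\le\alpha<\omega_1$) are defined recursively: $\omega^1=\omega$ and $\mathrm{fin}^{\otimes 1}=\mathrm{fin}$; $\omega^{\alpha+1}=\omega\times\omega^\alpha$ and $A\subseteq\omega^{\alpha+1}$ is in $\mathrm{fin}^{\otimes\alpha+1}$ iff for all but finitely many $n$, $(A)_n=\{y:(n,y)\in A\}\in\mathrm{fin}^{\otimes\alpha}$; for limit $\alpha$ one fixes an increasing sequence $\langle\alpha_n:n<\omega\rangle$ of nonzero ordinals with supremum $\alpha$, sets $\omega^\alpha=\biguplus_{n<\omega}\{n\}\times\omega^{\alpha_n}$, and $A\subseteq\omega^\alpha$ is in $\mathrm{fin}^{\otimes\alpha}$ iff for all but finitely many $n$, $(A)_n\in\mathrm{fin}^{\otimes\alpha_n}$. The forcing $P(\omega^\alpha)/\mathrm{fin}^{\otimes\alpha}$ is the set of subsets of $\omega^\alpha$ not in $\mathrm{fin}^{\otimes\alpha}$, ordered by $A\le B$ iff $A\setminus B\in\mathrm{fin}^{\otimes\alpha}$; it is $\sigma$-closed and adds no new reals. For a filter $U$ on $X$ and a filter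 $V$ on $Y$, the Fubini product $U\cdot V$ is the filter on $X\times Y$ given by $A\in U\cdot V$ iff $\{x\in X:\{y:(x,y)\in A\}\in V\}\in U$. For posets $P,Q$, $P\le_T Q$ means there is $f:Q\to P$ mapping every cofinal subset of $Q$ onto a cofinal subset of $P$; $P\equiv_T Q$ means $P\le_T Q$ and $Q\le_T P$. Filters are ordered by reverse inclusion $\supseteq$. *)

(* Defs.v *)
From mathcomp Require Import all_boot all_order.
From mathcomp Require Import boolp classical_sets functions cardinality.

Set Implicit Arguments.
Unset Strict Implicit.
Unset Printing Implicit Defensive.

Local Open Scope classical_set_scope.

(* The ground model V is the universe of types, with classical logic and       *)
(* choice.  Its sets are represented by well-founded trees, as in the          *)
(* Aczel-Werner model of set theory: [ZSet el] is the set of all [el i].       *)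
Inductive zset : Type := ZSet (T : Type) (el : T -> zset).

(* n + 1 = n U {n} *)
Fixpoint znum (n : nat) : zset :=
  if n is m.+1 then
    let: ZSet T el := znum m in
    ZSet (fun o : option T => if o is Some i then el i else znum m)
  else ZSet (fun i : void => match i with end).

Definition zpair (a b : zset) : zset :=
  let upair x y := ZSet (fun c : bool => if c then x else y) in
  upair (upair a a) (upair a b).

(* [code] says which element of the set-theoretic universe each point is. *)
Record ideal_space := IdealSpace {
  carrier :> Type;
  code : carrier -> zset;
  ideal : set (set carrier) }.
Arguments ideal : clear implicits.

Definition fin_space : ideal_space :=
  @IdealSpace nat znum (@finite_set nat).

Definition section (T : nat -> Type) (A : set {n : nat & T n}) (n : nat) :
  set (T n) := [set y | A (existT T n y)].
Arguments section {T} A n.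

(* The disjoint union of the {n} x S n, which is omega x S if S is constant. *)
Definition fubini_sum (S : nat -> ideal_space) : ideal_space :=
  @IdealSpace {n : nat & S n}
    (fun x => zpair (znum (tag x)) (code (tagged x)))
    [set A : set {n : nat & S n} |
      finite_set [set n | ~ ideal (S n) (section A n)]].

Section OrdinalPowers.
Context (d : Order.disp_t) (W : orderType d).
Implicit Types a b c : W.

(* Up to isomorphism, these properties characterize the ordinal omega_1. *)
Record is_omega1 : Prop := IsOmega1 {
  omega1_wf : well_founded (fun a b => (a < b)%O);
  omega1_initial : forall a, countable [set b | (b < a)%O];
  omega1_uncountable : ~ countable [set: W] }.

Definition is_zero a : Prop := forall b, (a <= b)%O.

Definition is_succ b a : Prop :=
  (b < a)%O /\ forall c, (b < c)%O -> (a <= c)%O.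

Definition is_one a : Prop := exists2 z, is_zero z & is_succ z a.

Definition is_limit a : Prop := ~ is_zero a /\ forall b, ~ is_succ b a.

Definition ladder_system (L : W -> nat -> W) : Prop :=
  forall a, is_limit a ->
    [/\ (forall n, ~ is_zero (L a n)),
        (forall m n, m < n -> (L a m < L a n)%O) &
        supremums (range (L a)) a].

Definition fin_power_step (L : W -> nat -> W) a
    (rec : forall b, (b < a)%O -> ideal_space) : ideal_space :=
  let rec' b := if pselect (b < a)%O is left lt_ba then rec b lt_ba
                else fin_space in
  if pselect (is_one a) then fin_space
  else if pselect (exists b, is_succ b a) is left ex_b
       then fubini_sum (fun=> rec' (projT1 (cid ex_b)))
       else fubini_sum (fun n => rec' (L a n)).

(* The set omega^a with the ideal fin^{(x) a}; the value at 0 is irrelevant. *)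
Definition fin_power (wf : well_founded (fun a b : W => (a < b)%O))
    (L : W -> nat -> W) : W -> ideal_space :=
  Fix wf (fun=> ideal_space) (fin_power_step L).

Section Equations.
Variables (wf : well_founded (fun a b : W => (a < b)%O)) (L : W -> nat -> W).

Lemma fin_powerE a :
  fin_power wf L a = fin_power_step L (fun b (_ : (b < a)%O) => fin_power wf L b).
Proof.
rewrite /fin_power Fix_eq // => x f g fg; congr fin_power_step.
by apply: functional_extensionality_dep => y;
   apply: functional_extensionality_dep => h.
Qed.

Lemma fin_power_one a : is_one a -> fin_power wf L a = fin_space.
Proof. by rewrite fin_powerE /fin_power_step; case: (pselect (is_one a)). Qed.

Lemma fin_power_succ b a : ~ is_zero b -> is_succ b a ->
  fin_power wf L a = fubini_sum (fun=> fin_power wf L b).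
Proof.
have succ_inj x y z : is_succ x z -> is_succ y z -> (x <= y)%O.
  move=> [xz _] [_ hy]; rewrite Order.TotalTheory.leNgt; apply/negP => yx.
  by move: (Order.POrderTheory.lt_le_trans xz (hy _ yx));
     rewrite Order.POrderTheory.ltxx.
have succ_eq x y z : is_succ x z -> is_succ y z -> x = y.
  by move=> hx hy; apply: Order.POrderTheory.le_anti;
     rewrite (succ_inj _ _ _ hx hy) (succ_inj _ _ _ hy hx).
move=> b0 ba; rewrite fin_powerE /fin_power_step.
case: (pselect (is_one a)) => [[z z0 za]|?].
  by exfalso; apply: b0; rewrite (succ_eq _ _ _ ba za).
case: (pselect (exists _, _)) => [ex_b|]; last by case; exists b.
case: cid => c /= ca; rewrite (succ_eq _ _ _ ca ba).
by case: pselect => // - []; case: ba.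
Qed.

Lemma fin_power_limit a : ladder_system L -> is_limit a ->
  fin_power wf L a = fubini_sum (fun n => fin_power wf L (L a n)).
Proof.
move=> hL la; have [_ mono [ub _]] := hL a la.
rewrite fin_powerE /fin_power_step.
case: (pselect (is_one a)) => [[z z0 za]|?]; first by exfalso; case: la => _ /(_ z).
case: (pselect (exists _, _)) => [ex_b|?]; first by exfalso; case: ex_b => z za; case: la => _ /(_ z).
congr fubini_sum; apply: funext => n; case: pselect => // - [].
by apply: Order.POrderTheory.lt_le_trans (mono n n.+1 _) (ub _ _) => //; exists n.+1.
Qed.

End Equations.
End OrdinalPowers.

(* P(omega^a)/fin^{(x) a}: the sets that are not in the ideal, ordered by      *)
(* inclusion modulo the ideal.                                                 *)
Definition positive_set (X : ideal_space) : Type := {A : set X | ~ ideal X A}.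

Definition le_mod (X : ideal_space) (A B : positive_set X) : Prop :=
  ideal X (sval A `\` sval B).

Definition code_set (X : ideal_space) (A : set X) : zset :=
  ZSet (fun x : {x : X | A x} => code (sval x)).

(* P-names; [Name el lab] is the set of pairs {(el i, lab i) : i in I}. *)
Inductive name (P : Type) : Type :=
  Name (T : Type) (el : T -> name P) (lab : T -> P).

(* The canonical name of a ground model set.  Its elements carry all           *)
(* conditions as labels, which amounts to labelling them by the largest one.   *)
Fixpoint check (P : Type) (x : zset) : name P :=
  let: ZSet T el := x in
  Name (fun ip : T * P => check P (el ip.1)) (fun ip => ip.2).

(* The canonical name {(check A, A) : A a condition} of the generic filter on  *)
(* P(omega^a)/fin^{(x) a}.                                                     *)
Definition generic_filter (X : ideal_space) : name (positive_set X) :=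
  Name (fun A : positive_set X => check _ (code_set (sval A))) id.

(* A formula of the forcing language, with names as parameters, is identified *)
(* with the set {p : p ||- phi}, and the connectives are the clauses of the    *)
(* recursive definition of ||-.                                                *)
Section Forcing.
Context (P : Type) (le : P -> P -> Prop).

Definition formula : Type := P -> Prop.

Definition dense_below (D : P -> Prop) (p : P) : Prop :=
  forall q, le q p -> exists2 r, le r q & D r.

Fixpoint feq (a b : name P) {struct a} : formula :=
  let: Name T x s := a in
  let: Name T' y t := b in
  fun p =>
    (forall i q, le q p -> le q (s i) ->
       dense_below (fun r => exists2 j, le r (t j) & feq (x i) (y j) r) q) /\
    (forall j q, le q p -> le q (t j) ->
       dense_below (fun r => exists2 i, le r (s i) & feq (x i) (y j) r) q).

Definition fmem (a b : name P) : formula :=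
  let: Name T' y t := b in
  dense_below (fun q => exists2 j, le q (t j) & feq a (y j) q).

Definition fand (f g : formula) : formula := fun p => f p /\ g p.

Definition for_ (f g : formula) : formula :=
  dense_below (fun q => f q \/ g q).

Definition fimp (f g : formula) : formula :=
  fun p => forall q, le q p -> f q -> g q.

Definition fiff (f g : formula) : formula := fand (fimp f g) (fimp g f).

Definition fnot (f : formula) : formula := fun p => forall q, le q p -> ~ f q.

Definition fall (f : name P -> formula) : formula := fun p => forall x, f x p.

Definition fex (f : name P -> formula) : formula :=
  dense_below (fun q => exists x, f x q).

(* phi holds in V[G] for every V-generic G iff every condition forces phi. *)
Definition forced (f : formula) : Prop := forall p, f p.

Local Notation "a ≐ b" := (feq a b) (at level 70).
Local Notation "a ∈ b" := (fmem a b) (at level 70).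
Local Notation "f ⊓ g" := (fand f g) (at level 75, right associativity).
Local Notation "f ⊔ g" := (for_ f g) (at level 76, right associativity).
Local Notation "f ⟹ g" := (fimp f g) (at level 78, right associativity).
Local Notation "f ⟺ g" := (fiff f g) (at level 77, no associativity).
Local Notation "'All' x .. y , f" :=
  (fall (fun x => .. (fall (fun y => f)) .. ))
  (at level 200, x binder, y binder, right associativity).
Local Notation "'Ex' x .. y , f" :=
  (fex (fun x => .. (fex (fun y => f)) .. ))
  (at level 200, x binder, y binder, right associativity).

Implicit Types (phi : name P -> formula) (a b c f x y z A B C X Y U W : name P).

Definition fsubset a b : formula := All x, x ∈ a ⟹ x ∈ b.

(* a = {x : phi x} *)
Definition is_class a phi : formula := All x, x ∈ a ⟺ phi x.

(* {x : phi x} is an element of b *)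
Definition class_in phi b : formula := Ex a, a ∈ b ⊓ is_class a phi.

(* Kuratowski pair: c = {{a}, {a, b}} *)
Definition is_pair c a b : formula :=
  is_class c (fun u => is_class u (fun v => v ≐ a) ⊔
                       is_class u (fun v => v ≐ a ⊔ v ≐ b)).

Definition pair_in a b R : formula := Ex c, c ∈ R ⊓ is_pair c a b.

Definition subset_of_prod R X Y : formula :=
  All c, c ∈ R ⟹ Ex x y, x ∈ X ⊓ y ∈ Y ⊓ is_pair c x y.

Definition is_ultrafilter U X : formula :=
  (All A, A ∈ U ⟹ fsubset A X) ⊓
  X ∈ U ⊓
  (All A, A ∈ U ⟹ Ex x, x ∈ A) ⊓
  (All A B, A ∈ U ⟹ B ∈ U ⟹ class_in (fun x => x ∈ A ⊓ x ∈ B) U) ⊓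
  (All A B, A ∈ U ⟹ fsubset A B ⟹ fsubset B X ⟹ B ∈ U) ⊓
  (All A, fsubset A X ⟹
     A ∈ U ⊔ class_in (fun x => x ∈ X ⊓ fnot (x ∈ A)) U).

(* W = U . V, for U a filter on X and V a filter on Y *)
Definition is_fubini_product W U X V Y : formula :=
  is_class W (fun A =>
    subset_of_prod A X Y ⊓
    class_in (fun x =>
      x ∈ X ⊓ class_in (fun y => y ∈ Y ⊓ pair_in x y A) V) U).

Definition is_function f X Y : formula :=
  subset_of_prod f X Y ⊓
  (All x, x ∈ X ⟹
     Ex y, pair_in x y f ⊓ All z, pair_in x z f ⟹ z ≐ y).

(* {x : phi x} is a cofinal subset of the poset (D, ord) *)
Definition cofinal D (ord : name P -> name P -> formula) phi : formula :=
  (All x, phi x ⟹ x ∈ D) ⊓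
  (All x, x ∈ D ⟹ Ex y, phi y ⊓ ord x y).

Definition tukey_le D ordD E ordE : formula :=
  Ex f, is_function f E D ⊓
    All C, cofinal E ordE (fun x => x ∈ C) ⟹
           cofinal D ordD (fun y => Ex x, x ∈ C ⊓ pair_in x y f).

Definition tukey_equiv D ordD E ordE : formula :=
  tukey_le D ordD E ordE ⊓ tukey_le E ordE D ordD.

(* Larger elements of the poset are smaller sets. *)
Definition reverse_inclusion a b : formula := fsubset b a.

End Forcing.

(* Main.v *)
Require Import Defs.
From mathcomp Require Import all_boot all_order.
From mathcomp Require Import boolp classical_sets functions cardinality.

(* The forcing is sigma-closed and omega^a is countable, so all subsets of     *)
(* omega^a and of its square in V[G] lie in V, and a condition p can decide    *)
(* which fibers R_s of R are in G; then p forces R to be in G . G iff          *)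
(* p <= {s : p <= R_s}.  Both Tukey maps are monotone maps of V.  From G . G   *)
(* to G, take R to its domain; this is cofinal because B x omega^a goes to B.  *)
(* From G to G . G, use that the ideal has a cofinal family J_g which is       *)
(* increasing in g : omega -> omega, and send B to the set of all (s, t) in    *)
(* B x B with t outside J_(h_(B,s)), where h_(B,s) is a function growing as    *)
(* fast as the gaps in the projection of B to the first coordinate.  Given R,  *)
(* choose g_s with p \ R_s contained in J_(g_s); the projection of a small     *)
(* enough B <= p has gaps so large that h_(B,s) dominates g_s for all s, so    *)
(* that B, and any B' in G contained in it, is mapped to a subset of R.        *)

Set Implicit Arguments.
Unset Strict Implicit.
Unset Printing Implicit Defensive.

Local Open Scope classical_set_scope.

(** * The forcing language *)

(** Why G already computes G . G: a member R of G . G attaches to almost every s a fiber in G, and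
    once a condition q lies below that fiber modulo the ideal, the fiber contains q minus a set of
    the ideal. By [fin_power_basis] that error set is governed by a function from omega to omega. As
    omega^a is countable, the functions for all s are dominated by one function g, apart from
    finitely many arguments for each s. By [fin_power_thin], G contains sets whose gaps outgrow any
    given g, so a single B in G bounds both the set of first coordinates and all the error sets.

    The passage from V[G] to V rests on two facts. First, [dense_decide] and [fsubset_ground] use
    sigma-closure to show that every subset in V[G] of a countable ground model set is a ground
    model set. Hence G and G . G consist of check names, with membership described by [below]
    ([generic_represents]) and [below_fubini] ([fubini_represents], [generic_fubini_product]).
    Second, [ground_tukey] turns a map phi of V into a Tukey map of V[G], provided that for each B
    in the target some A in the source, found after strengthening the condition, satisfies phi A'
    [<=] B for all A' in the source with A' [<=] A. Of omega^a only four things matter: layers, a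
    basis of the ideal, countability and injective codes, all proved by induction on
    [fin_power_space]. *)

Class preorder (P : Type) (le : P -> P -> Prop) : Prop := Preorder {
  preorder_refl : forall p, le p p;
  preorder_trans : forall p q r, le p q -> le q r -> le p r }.

Section ForcingRelation.
Context (P : Type) (le : P -> P -> Prop).
Context {le_pre : preorder le}.
Local Hint Extern 0 (le _ _) => apply: preorder_refl : core.
Implicit Types (p q r : P) (f g : formula P) (D : P -> Prop).
Implicit Types (a b c x y z : name P).

Definition downward f := forall p q, le q p -> f p -> f q.
(** These are the regular open sets of conditions: what is forced densely below p is forced by p.
    The connectives preserve this property. *)
Definition regular f := downward f /\ forall p, dense_below le f p -> f p.

Lemma dense_belowI D p : downward D -> D p -> dense_below le D p.
Proof. by move=> Dd Dp q qp; exists q => //; apply: Dd Dp. Qed.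

Lemma dense_belowW D D' p : (forall q, le q p -> D q -> D' q) ->
  dense_below le D p -> dense_below le D' p.
Proof.
move=> DD' h q qp; have [r rq Dr] := h _ qp.
by exists r => //; apply: DD' => //; apply: preorder_trans rq qp.
Qed.

Lemma regular_dense D : regular (dense_below le D).
Proof.
split=> [p q qp h r rq|p h q qp]; first by apply: h; apply: preorder_trans rq qp.
have [r rq hr] := h _ qp; have [s sr Ds] := hr _ (preorder_refl r).
by exists s => //; apply: preorder_trans sr rq.
Qed.

(** The rule by which hypotheses of the form [fex], [for_] or [fmem] are opened: a regular goal may
    be proved after strengthening the condition to obtain a witness. *)
Lemma dense_belowE D f p : regular f -> dense_below le D p ->
  (forall q, le q p -> D q -> f q) -> f p.
Proof. by move=> [_ fl] h Df; apply: fl; apply: dense_belowW h. Qed.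

Lemma regular_and f g : regular f -> regular g -> regular (fand f g).
Proof.
move=> [fd fl] [gd gl]; split=> [p q qp [fp gp]|p h].
  by split; [apply: fd fp|apply: gd gp].
by split; [apply: fl|apply: gl]; apply: dense_belowW h => q _ [].
Qed.

Lemma regular_imp f g : regular f -> regular g -> regular (fimp le f g).
Proof.
move=> [fd fl] [gd gl]; split=> [p q qp h r rq|p h q qp fq].
  by apply: h; apply: preorder_trans rq qp.
apply: gl => r rq; have [s sr hs] := h _ (preorder_trans rq qp).
exists s => //; apply: hs => //; apply: fd fq; exact: preorder_trans sr rq.
Qed.

Lemma regular_not f : regular f -> regular (fnot le f).
Proof.
move=> [fd fl]; split=> [p q qp h r rq|p h q qp fq].
  by apply: h; apply: preorder_trans rq qp.
have [s sr hs] := h _ qp; apply: (hs s) => //; exact: fd fq.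
Qed.

Lemma regular_all (F : name P -> formula P) :
  (forall x, regular (F x)) -> regular (fall F).
Proof.
move=> Fr; split=> [p q qp h x|p h x]; first exact: (Fr x).1 (h x).
by apply: (Fr x).2; apply: dense_belowW h.
Qed.

Lemma regular_feq a b : regular (feq le a b).
Proof.
case: a b => T x s [T' y t]; split=> [p q qp [h1 h2]|p h].
  by split=> i r rq; [apply: h1|apply: h2]; apply: preorder_trans rq qp.
split=> i q qp qi.
  apply: (regular_dense _).2 => r rq.
  have [u ur [h1 _]] := h _ (preorder_trans rq qp).
  by exists u => //; apply: h1 => //; apply: preorder_trans (preorder_trans ur rq) qi.
apply: (regular_dense _).2 => r rq.
have [u ur [_ h1]] := h _ (preorder_trans rq qp).
by exists u => //; apply: h1 => //; apply: preorder_trans (preorder_trans ur rq) qi.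
Qed.

Lemma regular_fmem a b : regular (fmem le a b).
Proof. by case: b => T y t; apply: regular_dense. Qed.

Lemma regular_or f g : regular (for_ le f g).
Proof. exact: regular_dense. Qed.

Lemma regular_ex F : regular (fex le F).
Proof. exact: regular_dense. Qed.

Hint Resolve regular_dense regular_and regular_imp regular_not regular_all
  regular_feq regular_fmem regular_or regular_ex : core.

Lemma regular_subset a b : regular (fsubset le a b).
Proof. by rewrite /fsubset; auto. Qed.

Lemma regular_iff f g : regular f -> regular g -> regular (fiff le f g).
Proof. by rewrite /fiff; auto. Qed.

Lemma regular_class a (F : name P -> formula P) :
  (forall x, regular (F x)) -> regular (is_class le a F).
Proof. by move=> h; apply: regular_all => x; apply: regular_iff. Qed.

Lemma regular_pair c a b : regular (is_pair le c a b).
Proof. by apply: regular_class => x; apply: regular_or. Qed.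

Hint Resolve regular_subset regular_iff regular_class regular_pair : core.

Lemma feq_down a b p q : le q p -> feq le a b p -> feq le a b q.
Proof. exact: (regular_feq a b).1. Qed.

Lemma fmem_down a b p q : le q p -> fmem le a b p -> fmem le a b q.
Proof. exact: (regular_fmem a b).1. Qed.

Lemma fex_intro (F : name P -> formula P) x p :
  regular (F x) -> F x p -> fex le F p.
Proof. by move=> [Fd _] Fp q qp; exists q => //; exists x; apply: Fd Fp. Qed.

Lemma feq_refl a p : feq le a a p.
Proof.
elim: a p => T x IH s p; split=> i q qp qi r rq; exists r => //;
  by exists i => //; apply: preorder_trans rq qi.
Qed.

Lemma feq_sym a b p : feq le a b p -> feq le b a p.
Proof.
elim: a b p => T x IH s [T' y t] p [h1 h2]; split=> i q qp qi.
  by apply: dense_belowW (h2 i q qp qi) => r _ [j rj e]; exists j => //; apply: IH.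
by apply: dense_belowW (h1 i q qp qi) => r _ [j rj e]; exists j => //; apply: IH.
Qed.

Lemma feq_trans b a c p : feq le a b p -> feq le b c p -> feq le a c p.
Proof.
elim: a b c p => T x IH s [T' y t] [T'' z u] p [ab ba] [bc cb].
split=> i q qp qi.
  apply: (dense_belowE (regular_dense _) (ab i q qp qi)) => r rq [j rj e1].
  apply: dense_belowW (bc j r (preorder_trans rq qp) rj) => v vr [k vk e2].
  by exists k => //; apply: IH e2; apply: feq_down e1.
apply: (dense_belowE (regular_dense _) (cb i q qp qi)) => r rq [j rj e1].
apply: dense_belowW (ba j r (preorder_trans rq qp) rj) => v vr [k vk e2].
by exists k => //; apply: IH e2 _; apply: feq_down e1.
Qed.

Lemma fmem_eql a a' b p : feq le a a' p -> fmem le a b p -> fmem le a' b p.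
Proof.
case: b => T y t e; apply: dense_belowW => q qp [j qj e'].
by exists j => //; apply: feq_trans e'; apply: feq_sym; apply: feq_down e.
Qed.

Lemma fmem_eqr b b' a p : feq le b b' p -> fmem le a b p -> fmem le a b' p.
Proof.
case: b b' => T y t [T' y' t'] [h _] m.
apply: (dense_belowE (regular_dense _) m) => q qp [j qj e].
apply: dense_belowW (h j q qp qj) => r rq [k rk e'].
by exists k => //; apply: feq_trans e'; apply: feq_down e.
Qed.

Lemma fmem_el T (x : T -> name P) s i p : le p (s i) ->
  fmem le (x i) (Name x s) p.
Proof.
move=> pi q qp; exists q => //; exists i; first exact: preorder_trans qp pi.
exact: feq_refl.
Qed.

Lemma feq_ext a b p : (forall x q, le q p -> fmem le x a q <-> fmem le x b q) ->
  feq le a b p.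
Proof.
case: a b => T x s [T' y t] h; split=> i q qp qi.
  by have /(h _ _ qp) := fmem_el x qi.
have /(h _ _ qp) m := fmem_el y qi.
by apply: dense_belowW m => r _ [j rj e]; exists j => //; apply: feq_sym.
Qed.

(** Foundation, by induction on names: a condition forcing a name into itself can be strengthened to
    make the name equal to one of its own elements, which is then a member of itself. *)
Lemma fmem_irrefl a p : ~ fmem le a a p.
Proof.
elim: a p => T x IH s p h; have [q _ [j qj e]] := h _ (preorder_refl p).
by apply: (IH j q); apply: fmem_eqr e _; apply: fmem_el.
Qed.

Lemma fsubset_eq a a' b b' p : feq le a a' p -> feq le b b' p ->
  fsubset le a b p -> fsubset le a' b' p.
Proof.
move=> ea eb h x q qp xa; apply: fmem_eqr (feq_down qp eb) _; apply: h => //.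
exact: fmem_eqr (feq_sym (feq_down qp ea)) xa.
Qed.

Lemma is_classE a (F : name P -> formula P) p :
  is_class le a F p <-> forall x q, le q p -> fmem le x a q <-> F x q.
Proof.
split=> [h x q qp|h x]; first by have [h1 h2] := h x; split; [apply: h1|apply: h2].
by split=> q qp; have [] := h x q qp.
Qed.

(* Every condition is a label of each element, as in the names [check P x]. *)
Definition name_upair a b : name P :=
  Name (fun ip : bool * P => if ip.1 then a else b) (fun ip => ip.2).

Definition name_pair a b : name P :=
  name_upair (name_upair a a) (name_upair a b).

Lemma check_zpair (u v : zset) :
  check P (zpair u v) = name_pair (check P u) (check P v).
Proof.
by congr Name; apply: funext => -[[] q] /=; congr Name; apply: funext => -[[] r].
Qed.

Lemma fmem_upair x a b p :
  fmem le x (name_upair a b) p <-> for_ le (feq le x a) (feq le x b) p.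
Proof.
split; apply: dense_belowW => q _; first by case=> -[[] r] /= _; [left|right].
by case=> e; [exists (true, q)|exists (false, q)].
Qed.

Lemma fmem_upairl a b p : fmem le a (name_upair a b) p.
Proof. by apply/fmem_upair => q _; exists q => //; left; apply: feq_refl. Qed.

Lemma fmem_upairr a b p : fmem le b (name_upair a b) p.
Proof. by apply/fmem_upair => q _; exists q => //; right; apply: feq_refl. Qed.

Arguments fmem_upairl : clear implicits.
Arguments fmem_upairr : clear implicits.

Lemma fmem_upairxx x a p : fmem le x (name_upair a a) p <-> feq le x a p.
Proof.
split=> [/fmem_upair h|h]; last first.
  by apply/fmem_upair => q qp; exists q => //; left; apply: feq_down h.
by apply: (dense_belowE (regular_feq _ _) h) => q _ [].
Qed.

Lemma is_class_upair x a b p :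
  is_class le x (fun v => for_ le (feq le v a) (feq le v b)) p <->
  feq le x (name_upair a b) p.
Proof.
split=> [/is_classE h|e].
  apply: feq_ext => y q qp; apply: iff_trans (h y q qp) _.
  by apply: iff_sym; apply: fmem_upair.
apply/is_classE => y q qp; split=> [h|h].
  by apply/fmem_upair; apply: fmem_eqr h; apply: feq_down e.
by apply: fmem_eqr (feq_sym (feq_down qp e)) _; apply/fmem_upair.
Qed.

Lemma is_class_singleton x a p :
  is_class le x (fun v => feq le v a) p <-> feq le x (name_upair a a) p.
Proof.
split=> [/is_classE h|e].
  apply: feq_ext => y q qp; apply: iff_trans (h y q qp) _.
  by apply: iff_sym; apply: fmem_upairxx.
apply/is_classE => y q qp; split=> [h|h].
  by apply/fmem_upairxx; apply: fmem_eqr h; apply: feq_down e.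
by apply: fmem_eqr (feq_sym (feq_down qp e)) _; apply/fmem_upairxx.
Qed.

Lemma is_pairE c a b p : is_pair le c a b p <-> feq le c (name_pair a b) p.
Proof.
apply: iff_trans (is_class_upair _ _ _ _).
split=> /is_classE h; apply/is_classE => x q qp; apply: iff_trans (h x q qp) _;
  split; apply: dense_belowW => r _;
  by case=> [/is_class_singleton|/is_class_upair]; [left|right].
Qed.

Lemma pair_inE a b c p : pair_in le a b c p <-> fmem le (name_pair a b) c p.
Proof.
split=> [h|h]; last first.
  apply: (fex_intro (x := name_pair a b)); first by auto.
  by split=> //; apply/is_pairE; apply: feq_refl.
apply: (dense_belowE (regular_fmem _ _) h) => q _ [x [xc /is_pairE e]].
exact: fmem_eql xc.
Qed.

Lemma feq_upair a a' b b' p : feq le a a' p -> feq le b b' p ->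
  feq le (name_upair a b) (name_upair a' b') p.
Proof.
move=> ea eb; apply: feq_ext => x q qp.
have ea' := feq_down qp ea; have eb' := feq_down qp eb.
split=> /fmem_upair h; apply/fmem_upair; apply: dense_belowW h => r rq [] e.
- by left; apply: feq_trans e _; apply: feq_down ea'.
- by right; apply: feq_trans e _; apply: feq_down eb'.
- by left; apply: feq_trans e _; apply: feq_sym; apply: feq_down ea'.
- by right; apply: feq_trans e _; apply: feq_sym; apply: feq_down eb'.
Qed.

Lemma feq_pair a a' b b' p : feq le a a' p -> feq le b b' p ->
  feq le (name_pair a b) (name_pair a' b') p.
Proof. by move=> ea eb; apply: feq_upair; apply: feq_upair. Qed.

Lemma feq_singleton_upair x a b p :
  feq le (name_upair x x) (name_upair a b) p -> feq le a x p /\ feq le b x p.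
Proof.
by move=> /feq_sym e; split; apply/fmem_upairxx; apply: fmem_eqr e _;
  [apply: fmem_upairl|apply: fmem_upairr].
Qed.

Lemma feq_upair_cancel a b b' p :
  feq le (name_upair a b) (name_upair a b') p -> feq le b b' p.
Proof.
move=> e.
have /fmem_upair h : fmem le b (name_upair a b') p.
  exact: fmem_eqr e (fmem_upairr _ _ _).
apply: (dense_belowE (regular_feq _ _) h) => q qp [] e1 //.
have /fmem_upair h' : fmem le b' (name_upair a b) q.
  exact: fmem_eqr (feq_sym (feq_down qp e)) (fmem_upairr _ _ _).
apply: (dense_belowE (regular_feq _ _) h') => r rq [] e2; last exact: feq_sym.
by apply: feq_trans (feq_down rq e1) _; apply: feq_sym.
Qed.

(** The singleton of [a] equals the singleton of [a'] or the pair of [a'] and [b'], and [a'] is [a]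
    in both cases. Cancelling [a] twice then gives the second coordinates. *)
Lemma feq_pair_inj a a' b b' p : feq le (name_pair a b) (name_pair a' b') p ->
  feq le a a' p /\ feq le b b' p.
Proof.
move=> e; have ea : feq le a a' p.
  have /fmem_upair h : fmem le (name_upair a a) (name_pair a' b') p.
    exact: fmem_eqr e (fmem_upairl _ _ _).
  apply: (dense_belowE (regular_feq _ _) h) => q _ [] /feq_singleton_upair [e1 _];
  exact: feq_sym.
split=> //.
have {}e : feq le (name_pair a b) (name_pair a b') p.
  apply: feq_trans e _; apply: feq_pair; last exact: feq_refl.
  exact: feq_sym.
by apply: (@feq_upair_cancel a); apply: feq_upair_cancel e.
Qed.

(** * Names of ground model sets *)

Definition ground_set (K : Type) (c : K -> zset) (A : set K) : zset :=
  ZSet (fun k : {k : K | A k} => c (sval k)).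

(** Injectivity of a coding in the strong form that no condition forces two different codes to be
    equal, so membership in ground sets can be read off in V. *)
Definition separated (K : Type) (c : K -> zset) : Prop :=
  forall k k' p, feq le (check P (c k)) (check P (c k')) p -> k = k'.

(** For m < n the code of m is forced to be an element of that of n, so equal codes would contradict
    [fmem_irrefl]. *)
Lemma separated_znum : separated znum.
Proof.
have lt m n p : m < n -> fmem le (check P (znum m)) (check P (znum n)) p.
  elim: n => // n IH; rewrite ltnS leq_eqVlt => /orP[/eqP->|/IH].
    rewrite [znum n.+1]/=; case: (znum n) => T el q _; exists q => //.
    by exists (None, q) => //; apply: feq_refl.
  rewrite [znum n.+1]/=.
  case: (znum n) => T el; apply: dense_belowW => q _ [[i r] qr e].
  by exists (Some i, r).
move=> m n p e; case: (ltngtP m n) => // /(lt _ _ p) h.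
  by case: (fmem_irrefl (fmem_eqr (feq_sym e) h)).
by case: (fmem_irrefl (fmem_eqr e h)).
Qed.

Lemma separated_zpair K K' (c : K -> zset) (c' : K' -> zset) :
  separated c -> separated c' ->
  separated (fun k : K * K' => zpair (c k.1) (c' k.2)).
Proof.
move=> hc hc' [k k'] [l l'] p; cbv beta; rewrite !check_zpair.
by move=> /feq_pair_inj[/hc /= -> /hc' /= ->].
Qed.

Section GroundSets.
Context (K : Type) (c : K -> zset).
Hypothesis c_sep : separated c.
Implicit Types A B : set K.

Lemma fmem_ground_set x A p : fmem le x (check P (ground_set c A)) p <->
  dense_below le (fun q => exists2 k, A k & feq le x (check P (c k)) q) p.
Proof.
split; apply: dense_belowW => q _.
  by case=> -[[k Ak] r] /= _ e; exists k.
by case=> k Ak e; exists (exist _ k Ak, q).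
Qed.

Lemma fmem_ground_point k A p :
  fmem le (check P (c k)) (check P (ground_set c A)) p <-> A k.
Proof.
split=> [/fmem_ground_set h|Ak].
  by have [q _ [k' Ak' /c_sep ->]] := h _ (preorder_refl p).
by apply/fmem_ground_set => q _; exists q => //; exists k => //; apply: feq_refl.
Qed.

Lemma fsubset_ground_set A B p :
  fsubset le (check P (ground_set c A)) (check P (ground_set c B)) p <->
  A `<=` B.
Proof.
split=> [h k /fmem_ground_point kA|AB x q _ /fmem_ground_set h].
  by apply/fmem_ground_point; apply: (h _ p (preorder_refl p)); exact: kA.
by apply/fmem_ground_set; apply: dense_belowW h => r _ [k /AB Bk e]; exists k.
Qed.

Lemma separated_ground_set : separated (ground_set c).
Proof.
move=> A B p e; apply/seteqP; split; apply/(fsubset_ground_set _ _ p) => x q qp.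
  exact: fmem_eqr (feq_down qp e).
exact: fmem_eqr (feq_sym (feq_down qp e)).
Qed.

End GroundSets.

(** * Sigma-closed forcing adds no subsets of countable sets *)

Definition sigma_closed : Prop := forall s : nat -> P,
  (forall n, le (s n.+1) (s n)) -> exists q, forall n, le q (s n).

Section Decision.
Hypothesis le_sigma : sigma_closed.
Context (K : Type) (e : K -> nat).
Hypothesis e_inj : injective e.

(** Decide the formulas one at a time along a decreasing sequence of conditions and take a lower
    bound. *)
Lemma dense_decide (F : K -> formula P) p : (forall k, downward (F k)) ->
  dense_below le (fun q => forall k, F k q \/ fnot le (F k) q) p.
Proof.
(* [Q n] is the formula numbered [n], and is false when [e] does not take the value [n]. *)
move=> Fd p0 _; pose Q n q := exists2 k, e k = n & F k q.
have step (nq : nat * P) : exists r, le r nq.2 /\ (Q nq.1 r \/ fnot le (Q nq.1) r).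
  case: nq => n q /=; have [[r [rq Qr]]|h] := pselect (exists r, le r q /\ Q n r).
    by exists r; split=> //; left.
  by exists q; split=> //; right=> r rq Qr; apply: h; exists r.
have [f hf] := choice step.
pose s := fix s n := if n is m.+1 then f (m, s m) else p0.
have [q qs] : exists q, forall n, le q (s n).
  by apply: le_sigma => n /=; have [] := hf (n, s n).
exists q => [|k]; first exact: qs 0.
have [_ []] := hf (e k, s (e k)).
  move=> [k' /e_inj -> Fk]; left; apply: Fd Fk; exact: qs (e k).+1.
move=> h; right=> r rq Fr; apply: (h r); first exact: preorder_trans rq (qs (e k).+1).
by exists k.
Qed.

Lemma fsubset_ground (c : K -> zset) a p :
  fsubset le a (check P (ground_set c setT)) p ->
  dense_below le (fun q => exists A, feq le a (check P (ground_set c A)) q) p.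
Proof.
move=> sub p0 p0p.
have [q qp0 dec] := @dense_decide (fun k => fmem le (check P (c k)) a) p0
  (fun k => (regular_fmem _ _).1) p0 (preorder_refl _).
exists q => //; exists [set k | fmem le (check P (c k)) a q].
apply: feq_ext => x r rq.
have rp : le r p by exact: preorder_trans rq (preorder_trans qp0 p0p).
split=> h.
  have /fmem_ground_set hx := sub x r rp h.
  apply/fmem_ground_set; apply: dense_belowW hx => u ur [k _ ek]; exists k => //=.
  case: (dec k) => // /(_ u (preorder_trans ur rq)) []; apply: fmem_eql ek _.
  exact: fmem_down h.
move/fmem_ground_set: h => h; apply: (dense_belowE (regular_fmem _ _) h).
move=> u ur [k mk ek]; apply: fmem_eql (feq_sym ek) _.
by apply: fmem_down mk; apply: preorder_trans ur rq.
Qed.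

End Decision.

(* In V[G], [a] is the set of all ground model objects [c k] such that some    *)
(* condition in the generic filter satisfies [In k].                           *)
Definition represents (K : Type) (c : K -> zset) (In : K -> formula P) a :=
  forall x p, fmem le x a p <->
    dense_below le (fun q => exists2 k, In k q & feq le x (check P (c k)) q) p.

Definition ground_name (K : Type) (c : K -> zset) (In : K -> formula P) : name P :=
  Name (fun i : {kp : K * P | In kp.1 kp.2} => check P (c (sval i).1))
       (fun i => (sval i).2).

Lemma ground_name_represents (K : Type) (c : K -> zset) (In : K -> formula P) :
  (forall k, downward (In k)) -> represents c In (ground_name c In).
Proof.
move=> Ind x p; split; apply: dense_belowW => q _.
  by case=> -[[k r] kr] /= qr e; exists k => //; apply: Ind kr.
by case=> k kq e; exists (exist (fun kp : K * P => In kp.1 kp.2) (k, q) kq).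
Qed.

Lemma represents_mem (K : Type) (c : K -> zset) (In : K -> formula P) a k p :
  represents c In a -> downward (In k) -> In k p -> fmem le (check P (c k)) a p.
Proof.
move=> ra Ind kp; apply/ra => q qp; exists q => //; exists k; first exact: Ind kp.
exact: feq_refl.
Qed.

(* [phi] lives in the ground model and is turned into a Tukey map of V[G], so *)
(* [phi_cofinal] only has to be checked on sets of the ground model.          *)
Section GroundTukey.
Context (XE XD : Type) (cE : XE -> zset) (cD : XD -> zset).
Hypotheses (cE_sep : separated cE) (cD_sep : separated cD).
Context (InE : set XE -> formula P) (InD : set XD -> formula P).
Hypotheses (InE_down : forall A, downward (InE A))
           (InD_down : forall A, downward (InD A)).
Context (E D : name P).
Hypotheses (rE : represents (ground_set cE) InE E)
           (rD : represents (ground_set cD) InD D).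
Context (phi : set XE -> set XD).
Hypothesis phi_in : forall A p, InE A p -> InD (phi A) p.
Hypothesis phi_cofinal : forall B p, InD B p ->
  exists2 q, le q p & exists2 A, InE A q &
    forall A' r, le r q -> InE A' r -> A' `<=` A -> phi A' `<=` B.

Local Notation nE A := (check P (ground_set cE A)).
Local Notation nD A := (check P (ground_set cD A)).

Let F : name P :=
  ground_name (fun A => zpair (ground_set cE A) (ground_set cD (phi A))) InE.

Let pair_inF x y p : pair_in le x y F p <->
  dense_below le (fun q => exists2 A, InE A q &
    feq le x (nE A) q /\ feq le y (nD (phi A)) q) p.
Proof.
apply: iff_trans (pair_inE _ _ _ _) _.
apply: iff_trans (ground_name_represents _ InE_down _ _) _.
split; apply: dense_belowW => q _ [A Aq e]; exists A => //;
  move: e; rewrite check_zpair; first exact: feq_pair_inj.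
by case=> ex ey; apply: feq_pair.
Qed.

Let regular_pair_in x y z : regular (pair_in le x y z).
Proof. exact: regular_ex. Qed.

Lemma ground_tukey_function p : is_function le F E D p.
Proof.
split=> [u q qp /(ground_name_represents _ InE_down) h|x q qp xE].
  apply: dense_belowW h => r _ [A Ar e].
  exists (nE A); apply: (fex_intro (x := nD (phi A))); first by auto.
  split; first exact: represents_mem rE (InE_down (A := A)) Ar.
  split; first exact: represents_mem rD (InD_down (A := phi A)) (phi_in Ar).
  by apply/is_pairE; rewrite -check_zpair.
move/rE: xE; apply: dense_belowW => r _ [A Ar ex].
exists (nD (phi A)); split.
  by apply/pair_inF => s sr; exists s => //; exists A; [apply: InE_down Ar|
    split; [apply: feq_down ex|apply: feq_refl]].
move=> z s sr /pair_inF h; apply: (dense_belowE (regular_feq _ _) h).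
move=> t ts [A' A't [ex' ez]].
have tr : le t r by exact: preorder_trans ts sr.
(* [phi] is applied to the ground set itself, so single-valuedness needs the set to be determined by
   its name. *)
have <- // : A' = A.
apply: (separated_ground_set cE_sep) (feq_trans (feq_sym ex') (feq_down tr ex)).
Qed.

Lemma ground_tukey p :
  tukey_le le D (reverse_inclusion le) E (reverse_inclusion le) p.
Proof.
apply: (fex_intro (x := F)).
  apply: regular_and; last by rewrite /cofinal; auto 20.
  rewrite /is_function /subset_of_prod; auto 20.
split; first exact: ground_tukey_function.
move=> C q _ [Csub Ccof]; split.
  move=> y r rq h; apply: (dense_belowE (regular_fmem _ _) h).
  move=> s sr [x [xC /pair_inF xy]].
  apply: (dense_belowE (regular_fmem _ _) xy) => t ts [A At [ex ey]].
  apply: fmem_eql (feq_sym ey) _.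
  exact: represents_mem rD (InD_down (A := phi A)) (phi_in At).
move=> y r rq /rD h; apply: (dense_belowE (regular_ex _) h) => s sr [B Bs ey].
move=> s1 s1s; have [t ts1 [A At hA]] := phi_cofinal (InD_down s1s Bs).
have tq : le t q by apply: preorder_trans (preorder_trans (preorder_trans ts1 s1s) sr) rq.
have AE : fmem le (nE A) E t by exact: represents_mem rE (InE_down (A := A)) At.
(* Cofinality of [C] gives an element inside [A]; being in [E], it is the name of some [A'] below
   [A], and [phi A'] is the required element inside [B]. *)
have [u ut [x [xC xA]]] := Ccof (nE A) t tq AE _ (preorder_refl _).
have /rE xE : fmem le x E u by exact: Csub x u (preorder_trans ut tq) xC.
have [v vu [A' A'v ex]] := xE _ (preorder_refl u).
have vt : le v t by exact: preorder_trans vu ut.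
exists v; first exact: preorder_trans vt ts1.
exists (nD (phi A')); split.
  apply: (fex_intro (x := x)); first by auto.
  split; first exact: fmem_down vu xC.
  apply/pair_inF => w wv; exists w => //; exists A'; first exact: InE_down A'v.
  by split; [apply: feq_down ex|apply: feq_refl].
have vs : le v s by exact: preorder_trans vt (preorder_trans ts1 s1s).
apply: fsubset_eq (feq_refl _ _) (feq_sym (feq_down vs ey)) _.
apply/(fsubset_ground_set cD_sep); apply: hA vt A'v _.
apply/(fsubset_ground_set cE_sep _ _ v).
apply: fsubset_eq ex (feq_refl _ _) _.
exact: (regular_subset _ _).1 vu xA.
Qed.
End GroundTukey.

End ForcingRelation.

(** * The ideals on countable ordinal powers of omega *)

Lemma finite_natP (A : set nat) :
  finite_set A <-> exists k, forall n, A n -> n < k.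
Proof.
split=> [/finite_seqP[s ->]|[k Ak]].
  by exists (\max_(n <- s) n).+1 => n /= ns; rewrite ltnS; apply: leq_bigmax_seq.
by apply: sub_finite_set (finite_II k) => n /Ak.
Qed.

Lemma infinite_natP (A : set nat) :
  infinite_set A <-> forall k, exists2 n, A n & k < n.
Proof.
rewrite finite_natP; split=> [h k|h [k Ak]].
  apply: contrapT => nA; apply: h; exists k.+1 => n An; rewrite ltnS leqNgt.
  by apply/negP => kn; apply: nA; exists n.
by have [n /Ak nk kn] := h k; move: (ltn_trans nk kn); rewrite ltnn.
Qed.

Record proper_ideal (S : ideal_space) : Prop := ProperIdeal {
  ideal0 : ideal S set0;
  ideal_sub : forall A B : set S, A `<=` B -> ideal S B -> ideal S A;
  idealU : forall A B : set S, ideal S A -> ideal S B -> ideal S (A `|` B);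
  idealT : ~ ideal S setT }.

(* [big A n] says that [A] is positive on the [n]th layer of [S]. *)
Record layered (S : ideal_space) (layer : S -> nat)
    (big : set S -> nat -> Prop) : Prop := Layered {
  ideal_big : forall A, ideal S A <-> finite_set (big A);
  big_sub : forall (A B : set S) n,
    big A n -> (forall x, A x -> layer x = n -> B x) -> big B n;
  big0 : forall n, ~ big set0 n;
  bigU : forall A B n, big (A `|` B) n -> big A n \/ big B n;
  bigT : forall n, big setT n }.

(** Base, successor and limit stages are treated uniformly by induction on this class; [fin_powerP]
    is where the ordinals are traded for it. *)
Inductive fin_power_space : ideal_space -> Prop :=
| fin_power_fin : fin_power_space fin_space
| fin_power_sum S : (forall n, fin_power_space (S n)) ->
    fin_power_space (fubini_sum S).

Lemma layered_proper S layer big : @layered S layer big -> proper_ideal S.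
Proof.
case=> iE bs b0 bU bT; split.
- by apply/iE; apply: sub_finite_set (finite_set0 _) => n /b0.
- move=> A B AB /iE Bfin; apply/iE; apply: sub_finite_set Bfin => n An.
  by apply: bs An _ => x /AB.
- move=> A B /iE Afin /iE Bfin; apply/iE.
  apply: (@sub_finite_set _ _ (big A `|` big B)) => [n /bU//|].
  by rewrite finite_setU.
- by move=> /iE; apply: sub_infinite_set infinite_nat => n _; apply: bT.
Qed.

Lemma fin_space_layered :
  @layered fin_space id (fun A n => A n).
Proof.
by split=> // [A B n An AB|n []]; apply: AB.
Qed.

Lemma fubini_sum_layered S : (forall n, proper_ideal (S n)) ->
  @layered (fubini_sum S) (@tag _ _)
    (fun A n => ~ ideal (S n) (section A n)).
Proof.
move=> Sp; split=> //=.
- move=> A B n An AB Bn; apply: An; apply: (ideal_sub (Sp n)) Bn => y Ay.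
  exact: AB.
- by move=> n; apply; exact: ideal0.
- move=> A B n AB; apply: contrapT => /not_orP[/contrapT An /contrapT Bn].
  by apply: AB; apply: idealU.
- by move=> n; apply: idealT.
Qed.

(** The layers are single points for [fin_space] and the summands for a Fubini sum. In both cases a
    set is in the ideal iff it is big on only finitely many layers. *)
Lemma fin_power_layered S : fin_power_space S ->
  exists layer big, @layered S layer big.
Proof.
elim=> [|{}S _ IH]; first by exists id, (fun A n => A n); exact: fin_space_layered.
do 2!eexists; apply: fubini_sum_layered => n.
by have [l [b h]] := IH n; apply: layered_proper h.
Qed.

Lemma fin_power_proper S : fin_power_space S -> proper_ideal S.
Proof. by move/fin_power_layered => [l [b h]]; apply: layered_proper h. Qed.

Lemma fin_power_countable S : fin_power_space S ->
  exists e : S -> nat, injective e.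
Proof.
elim=> [|{}S _ IH]; first by exists id.
have e_ n : {e : S n -> nat | injective e} by apply/cid/IH.
exists (fun x => pickle (tag x, sval (e_ (tag x)) (tagged x))) => -[n x] [m y].
move=> /(pcan_inj pickleK) /= [nm]; case: m / nm y => y.
by move/(svalP (e_ n)) ->.
Qed.

(** A monotone map with cofinal range from omega^omega, ordered pointwise, into the ideal. *)
Definition ideal_basis (S : ideal_space) (J : (nat -> nat) -> set S) : Prop :=
  [/\ forall g g', (forall n, g n <= g' n) -> J g `<=` J g',
      forall g, ideal S (J g) &
      forall A, ideal S A -> exists g, A `<=` J g].

Lemma fin_power_basis S : fin_power_space S -> exists J, @ideal_basis S J.
Proof.
elim=> [|{}S Sn IH].
  exists (fun g => [set n | n < g 0]); split=> [g g' gg' n /= ng|g|A].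
  - exact: leq_trans ng (gg' 0).
  - exact: finite_II.
  - by move=> /finite_natP[k Ak]; exists (fun=> k).
pose J n := sval (cid (IH n)).
have JP n : ideal_basis (J n) := svalP (cid (IH n)).
(* [g 0] bounds the layers that are included entirely. The remaining values of [g], shifted by one
   and split by [pickle], give one function for each layer. *)
exists (fun g => [set x : {n : nat & S n} | tag x < g 0 \/
  J (tag x) (fun k => g (pickle (tag x, k)).+1) (tagged x)]).
split=> [g g' gg' [n y] /= [h|h]|g|A].
- by left; apply: leq_trans h (gg' 0).
- by right; have [Jm _ _] := JP n; apply: Jm h.
- apply/finite_natP; exists (g 0) => n; rewrite ltnNge => nJ.
  apply/negP => gn; apply: nJ; have [_ JI _] := JP n.
  apply: (ideal_sub (fin_power_proper (Sn n))) (JI (fun k => g (pickle (n, k)).+1)).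
  by move=> y [/=|//]; rewrite ltnNge gn.
- move=> /finite_natP[k Ak].
  have /choice [h hP] : forall n, exists h, k <= n -> section A n `<=` J n h.
    move=> n; have [_ _ Jc] := JP n.
    have [/Jc[h Ah]|nA] := pselect (ideal (S n) (section A n)); first by exists h.
    by exists id => kn; have := Ak n nA; rewrite ltnNge kn.
  pose g i := if i is j.+1 then
    if unpickle j is Some (n, m) then h n m else 0 else k.
  exists g => -[n y] /= Any; case: (ltnP n k) => [|/hP sub]; [by left|right].
  have -> : (fun m => g (pickle (n, m)).+1) = h n.
    by apply: funext => m; rewrite /g pickleK.
  exact: sub.
Qed.

(** * The order of the forcing *)

Lemma le_mod_refl S (A : positive_set S) : proper_ideal S -> le_mod A A.
Proof. by move=> /ideal0; rewrite /le_mod setDv. Qed.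

Lemma le_mod_trans S (A B C : positive_set S) : proper_ideal S ->
  le_mod A B -> le_mod B C -> le_mod A C.
Proof.
move=> hS AB BC; apply: (ideal_sub hS) (idealU hS AB BC) => x [Ax nCx].
by have [Bx|nBx] := pselect (sval B x); [right|left].
Qed.

Lemma infinite_nextP (T : nat -> set nat) : (forall n, infinite_set (T n)) ->
  forall g : nat -> nat, exists2 t : nat -> nat,
    forall n, T n (t n) & forall i j, i < j -> maxn (t i) (g (t i)) < t j.
Proof.
move=> Tinf g.
have step (nk : nat * nat) : exists m, T nk.1 m /\ maxn nk.2 (g nk.2) < m.
  by have /infinite_natP /(_ (maxn nk.2 (g nk.2))) [m] := Tinf nk.1; exists m.
have [f fP] := choice step.
pose t := fix t n := if n is m.+1 then f (m.+1, t m) else f (0, 0).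
exists t => [[|n]|i j]; [exact: (fP (0, 0)).1|exact: (fP (n.+1, t n)).1|].
have tS n : maxn (t n) (g (t n)) < t n.+1 by exact: (fP (n.+1, t n)).2.
elim: j => // j IH; rewrite ltnS leq_eqVlt => /orP[/eqP->//|/IH /leq_trans]; apply.
by apply: ltnW; apply: leq_ltn_trans (leq_maxl _ _) (tS j).
Qed.

Lemma increasing_infinite (t : nat -> nat) (A : set nat) :
  (forall i j, i < j -> t i < t j) -> (forall n, A (t n)) -> infinite_set A.
Proof.
move=> tm At; apply/infinite_natP => k; exists (t k.+1) => //.
have : forall n, n <= t n by elim=> // n IH; apply: leq_ltn_trans IH (tm _ _ _).
by apply.
Qed.

(** A diagonal intersection: [A n] is the intersection of the first conditions, up to [s n], and the
    lower bound takes from each [A n] one layer [t n] on which it is big. *)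
Lemma fin_power_sigma_closed S : fin_power_space S -> sigma_closed (@le_mod S).
Proof.
move=> hS s sdec; have pS := fin_power_proper hS.
have [layer [big hl]] := fin_power_layered hS.
pose A n : set S := fun x => forall i, i <= n -> sval (s i) x.
have sA n : ideal S (sval (s n) `\` A n).
  elim: n => [|n IH].
    apply: (ideal_sub pS) (ideal0 pS) => x [sx] []; by move=> i; rewrite leqn0 => /eqP->.
  apply: (ideal_sub pS) (idealU pS (sdec n) IH) => x [sx nA].
  have [sx'|nsx] := pselect (sval (s n) x); [right|by left].
  split=> // Anx; apply: nA => i; rewrite leq_eqVlt => /orP[/eqP->//|].
  exact: Anx.
have Ainf n : infinite_set (big (A n)).
  move/(ideal_big hl) => An; apply: (svalP (s n)).
  apply: (ideal_sub pS) (idealU pS (sA n) An) => x sx.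
  by have [|] := pselect (A n x); [right|left].
have [t At tm] := infinite_nextP Ainf id.
have {}tm i j : i < j -> t i < t j by move=> /tm; rewrite maxnn.
pose B : set S := fun x => exists2 n, A n x & layer x = t n.
have Bpos : ~ ideal S B.
  move/(ideal_big hl); apply: (increasing_infinite tm) => n.
  by apply: (big_sub hl) (At n) _ => x Anx lx; exists n.
exists (exist _ B Bpos) => n; apply/(ideal_big hl).
apply: sub_finite_set (finite_image t (finite_II n)) => j /= bj.
apply: contrapT => jn; apply: (big0 hl (n := j)).
apply: (big_sub hl) bj _ => x [[m Am lx] nsx] xj; apply: jn.
exists m; last by rewrite -lx.
by rewrite /= ltnNge; apply/negP => nm; apply: nsx; exact: Am.
Qed.

Lemma fin_power_thin (S : ideal_space) layer big (A : set S) (g : nat -> nat) :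
  @layered S layer big -> ~ ideal S A ->
  exists2 B, B `<=` A & ~ ideal S B /\
    forall x y, B x -> B y -> layer x < layer y -> g (layer x) < layer y.
Proof.
move=> hl Apos; have Ainf : infinite_set (big A) by move/(ideal_big hl).
have [t At tm] := infinite_nextP (fun=> Ainf) g.
have tm' i j : i < j -> t i < t j.
  by move=> /tm; apply: leq_ltn_trans; apply: leq_maxl.
exists (fun x => A x /\ exists n, layer x = t n); first by move=> x [].
split=> [/(ideal_big hl)|x y [_ [n ->]] [_ [m ->]] lt].
  apply: (increasing_infinite tm') => n.
  by apply: (big_sub hl) (At n) _ => x Ax lx; split=> //; exists n.
apply: leq_ltn_trans (leq_maxr _ _) (tm _ _ _).
case: (ltngtP n m) lt => // [/tm' lt1 lt2|->]; last by rewrite ltnn.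
by move: (ltn_trans lt1 lt2); rewrite ltnn.
Qed.

Lemma fin_powerP d (W : orderType d)
    (wf : well_founded (fun a b : W => (a < b)%O))
    (L : W -> nat -> W) (a : W) : ladder_system L -> ~ is_zero a ->
  fin_power_space (fin_power wf L a).
Proof.
move=> hL; elim/(well_founded_ind wf): a => a IH a0.
have [a1|na1] := pselect (is_one a); first by rewrite fin_power_one //; left.
have [[b ba]|nsucc] := pselect (exists b, is_succ b a).
  have b0 : ~ is_zero b by move=> b0; apply: na1; exists b.
  by rewrite (fin_power_succ _ _ b0 ba); right=> _; apply: IH => //; case: ba.
have la : is_limit a by split=> // b ba; apply: nsucc; exists b.
have [L0 Lm [Lub _]] := hL a la.
rewrite (fin_power_limit _ hL la); right=> n; apply: IH => //.
by apply: Order.POrderTheory.lt_le_trans (Lm n n.+1 _) (Lub _ _) => //; exists n.+1.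
Qed.

Lemma fin_power_separated P (le : P -> P -> Prop) (le_pre : preorder le) S :
  fin_power_space S -> separated le (@code S).
Proof.
elim=> [|{}S _ IH]; first exact: separated_znum.
move=> [n x] [m y] p.
change (feq le (check P (zpair (znum n) (code x)))
               (check P (zpair (znum m) (code y))) p -> existT S n x = existT S m y).
rewrite !check_zpair => h; case: (feq_pair_inj h) => {}h.
have {h}nm : n = m by exact: separated_znum h.
by case: m / nm y => y /IH ->.
Qed.

(** * The generic ultrafilter *)

Section Generic.
Context (S : ideal_space) (hS : fin_power_space S).
Let P : Type := positive_set S.
Let le : P -> P -> Prop := @le_mod S.
Let X : name P := check P (code_set (@setT S)).
Let G : name P := generic_filter S.
Implicit Types (p q r : P) (A B : set S) (R : set (S * S)).

Let pS : proper_ideal S := fin_power_proper hS.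

#[local] Instance le_mod_preorder : preorder le.
Proof.
split=> [A|A B C]; [exact: le_mod_refl|exact: le_mod_trans].
Qed.

Let le_sigma : sigma_closed le := fin_power_sigma_closed hS.
Let code_sep : separated le (@code S) := fin_power_separated _ hS.

Definition code2 (s : S * S) : zset := zpair (code s.1) (code s.2).
Let code2_sep : separated le code2 := separated_zpair code_sep code_sep.

Local Notation nset A := (check P (ground_set (@code S) A)).
Local Notation nrel R := (check P (ground_set code2 R)).

(** [le_mod] with [A] not assumed positive. By [generic_mem] this is what it means for p to force A
    into G. *)
Definition below A : formula P := fun p => ideal S (sval p `\` A).

Lemma belowW A B p : A `<=` B -> below A p -> below B p.
Proof. by move=> AB; apply: (ideal_sub pS) => x [px nBx]; split=> // /AB. Qed.

Lemma below_sub A p : sval p `<=` A -> below A p.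
Proof. by move=> pA; apply: (ideal_sub pS) (ideal0 pS) => x [/pA]. Qed.

Lemma belowI A B p : below A p -> below B p -> below (A `&` B) p.
Proof.
move=> pA pB; apply: (ideal_sub pS) (idealU pS pA pB) => x [px nAB].
by have [Ax|nAx] := pselect (A x); [right|left]; split=> // Bx; apply: nAB.
Qed.

Lemma below_pos A p : below A p -> ~ ideal S A.
Proof.
move=> pA AI; apply: (svalP p); apply: (ideal_sub pS) (idealU pS pA AI) => x px.
by have [Ax|nAx] := pselect (A x); [right|left].
Qed.

Lemma below_nonempty A p : below A p -> exists x, A x.
Proof.
move=> /below_pos Apos; apply: contrapT => nA; apply: Apos.
by apply: (ideal_sub pS) (ideal0 pS) => x Ax; apply: nA; exists x.
Qed.

Lemma below_down A : downward le (below A).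
Proof.
move=> p q qp pA; apply: (ideal_sub pS) (idealU pS qp pA) => x [qx nAx].
by have [px|npx] := pselect (sval p x); [right|left].
Qed.

Lemma below_setI p A : ~ ideal S (sval p `&` A) ->
  exists2 q, le q p & below A q.
Proof.
move=> pApos; pose q : P := exist (fun B => ~ ideal S B) _ pApos.
exists q; first by apply: (@below_sub _ q) => x [].
by apply: below_sub => x [].
Qed.

(** Separativity: if p is not below A, then p minus A is positive, and nothing stronger than it is
    below A. *)
Lemma below_regular A : regular le (below A).
Proof.
split=> [|p h]; first exact: below_down.
apply: contrapT => pA.
have pos : ~ ideal S (sval p `&` ~` A) by [].
have [q qp qA] := below_setI pos.
have [r rq rA] := h q qp.
apply: (below_pos (belowI rA (below_down rq qA))).
by apply: (ideal_sub pS) (ideal0 pS) => x [].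
Qed.

Lemma generic_represents : represents le (ground_set (@code S)) below G.
Proof.
move=> x p; split; apply: dense_belowW => q _; first by case=> B qB e; exists (sval B).
by case=> B qB e; exists (exist (fun B => ~ ideal S B) B (below_pos qB)).
Qed.

Lemma generic_mem A p : fmem le (nset A) G p <-> below A p.
Proof.
split=> [/generic_represents h|pA].
  apply: (dense_belowE (below_regular A) h) => q _ [B qB].
  by move/(separated_ground_set code_sep) ->.
exact: represents_mem generic_represents (@below_down A) pA.
Qed.

Lemma generic_elim a p (f : formula P) : regular le f -> fmem le a G p ->
  (forall q B, le q p -> below B q -> feq le a (nset B) q -> f q) -> f p.
Proof.
move=> fr /generic_represents h hf; apply: (dense_belowE fr h) => q qp [B qB e].
exact: hf qB e.
Qed.

Lemma carrier_elim x p (f : formula P) : regular le f -> fmem le x X p ->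
  (forall q (s : S), le q p -> feq le x (check P (code s)) q -> f q) -> f p.
Proof.
move=> fr /fmem_ground_set h hf; apply: (dense_belowE fr h) => q qp [s _ e].
exact: hf e.
Qed.

Lemma carrier_mem (s : S) p : fmem le (check P (code s)) X p.
Proof. by apply/(fmem_ground_point code_sep). Qed.

Lemma nset_elim x A p (f : formula P) : regular le f -> fmem le x (nset A) p ->
  (forall q (s : S), le q p -> A s -> feq le x (check P (code s)) q -> f q) -> f p.
Proof.
move=> fr /fmem_ground_set h hf; apply: (dense_belowE fr h) => q qp [s As e].
exact: hf e.
Qed.

Let carrier_enum : exists e : S -> nat, injective e := fin_power_countable hS.

Lemma subset_elim a p (f : formula P) : regular le f -> fsubset le a X p ->
  (forall q A, le q p -> feq le a (nset A) q -> f q) -> f p.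
Proof.
have [e e_inj] := carrier_enum.
move=> fr /(fsubset_ground le_sigma e_inj) h hf.
by apply: (dense_belowE fr h) => q qp [A]; apply: hf.
Qed.

Lemma subset2_elim a p (f : formula P) : regular le f -> fsubset le a (nrel setT) p ->
  (forall q R, le q p -> feq le a (nrel R) q -> f q) -> f p.
Proof.
have [e e_inj] := carrier_enum.
have e2_inj : injective (fun s : S * S => pickle (e s.1, e s.2)).
  by move=> [s t] [s' t'] /(pcan_inj pickleK) [/e_inj -> /e_inj ->].
move=> fr /(fsubset_ground le_sigma e2_inj) h hf.
by apply: (dense_belowE fr h) => q qp [A]; apply: hf.
Qed.

Lemma generic_ultrafilter p : is_ultrafilter le G X p.
Proof.
repeat split.
- move=> a q _ aG; apply: (generic_elim _ aG); first exact: regular_subset.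
  move=> r B _ rB e; apply: fsubset_eq (feq_sym e) (feq_refl _ _) _.
  by apply/(fsubset_ground_set code_sep).
- by apply/generic_mem; apply: below_sub.
- move=> a q _ aG; apply: (generic_elim _ aG); first exact: regular_ex.
  move=> r B _ rB e; have [s Bs] := below_nonempty rB.
  apply: (fex_intro (x := check P (code s))); first exact: regular_fmem.
  by apply: fmem_eqr (feq_sym e) _; apply/(fmem_ground_point code_sep).
- move=> a b q _ aG r rq bG.
  apply: (generic_elim _ (fmem_down rq aG)); first exact: regular_ex.
  move=> u A ur uA ea; apply: (generic_elim _ (fmem_down ur bG)); first exact: regular_ex.
  move=> v B vu vB eb.
  apply: (fex_intro (x := nset (A `&` B))).
    apply: regular_and; first exact: regular_fmem.
    by apply: regular_class => x; apply: regular_and; apply: regular_fmem.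
  split; first by apply/generic_mem; apply: belowI vB; apply: below_down uA.
  apply/is_classE => x w wv.
  have {}ea : feq le a (nset A) w by exact: feq_down (preorder_trans wv vu) ea.
  have {}eb : feq le b (nset B) w by exact: feq_down wv eb.
  split=> [xAB|[xa xb]].
    split; [apply: fmem_eqr (feq_sym ea) _|apply: fmem_eqr (feq_sym eb) _];
    apply: (nset_elim _ xAB); try exact: regular_fmem;
    by move=> z s _ [As Bs] es; apply: fmem_eql (feq_sym es) _;
       apply/(fmem_ground_point code_sep).
  have xA : fmem le x (nset A) w by exact: fmem_eqr ea xa.
  have xB : fmem le x (nset B) w by exact: fmem_eqr eb xb.
  apply: (nset_elim _ xA); first exact: regular_fmem.
  move=> z s zw As es; apply: fmem_eql (feq_sym es) _.
  apply/(fmem_ground_point code_sep); split=> //.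
  apply/(fmem_ground_point code_sep _ _ z); apply: fmem_eql es _.
  exact: fmem_down zw xB.
- move=> a b q _ aG r rq ab u ur bX.
  apply: (generic_elim _ (fmem_down (preorder_trans ur rq) aG)).
    exact: regular_fmem.
  move=> v A vu vA ea; apply: (subset_elim _ ((regular_subset _ _).1 _ _ vu bX)).
    exact: regular_fmem.
  move=> w B wv eb; apply: fmem_eql (feq_sym eb) _; apply/generic_mem.
  apply: belowW (below_down wv vA); apply/(fsubset_ground_set code_sep _ _ w).
  apply: fsubset_eq (feq_down wv ea) eb _.
  exact: (regular_subset _ _).1 _ _ (preorder_trans wv (preorder_trans vu ur)) ab.
- move=> a q _ aX; apply: (subset_elim _ aX); first exact: regular_or.
  move=> r A _ ea u ur.
  (* Either u is already below the complement of A, or its trace on A is a stronger condition that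
     forces A into G. *)
  have [uA|/below_setI[v vu vA]] := pselect (ideal S (sval u `&` A)).
    exists u; first exact: preorder_refl.
    right; apply: (fex_intro (x := nset (~` A))).
      apply: regular_and; first exact: regular_fmem.
      apply: regular_class => x; apply: regular_and; first exact: regular_fmem.
      by apply: regular_not; apply: regular_fmem.
    split; first by apply/generic_mem; rewrite /below setDE setCK.
    apply/is_classE => x v vu; split=> [xA|[xX xA]].
      split.
        apply: (nset_elim _ xA) => [|w s _ _ es]; first exact: regular_fmem.
        by apply: fmem_eql (feq_sym es) _; apply: carrier_mem.
      move=> w wv xa.
      have /fmem_ground_set : fmem le x (nset (~` A)) w by exact: fmem_down wv xA.
      move=> /(_ w (preorder_refl w)) [z zw [s As es]].
      apply: As; apply/(fmem_ground_point code_sep _ _ z); apply: fmem_eql es _.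
      apply: fmem_eqr _ (fmem_down zw xa).
      apply: feq_down (preorder_trans zw (preorder_trans wv _)) ea.
      exact: preorder_trans vu ur.
    apply: (carrier_elim _ xX) => [|w s wv es]; first exact: regular_fmem.
    apply: fmem_eql (feq_sym es) _; apply/(fmem_ground_point code_sep) => As.
    apply: (xA w wv); apply: fmem_eql (feq_sym es) _.
    apply: fmem_eqr (feq_sym (feq_down _ ea)) _.
      by apply: preorder_trans ur; apply: preorder_trans vu.
    by apply/(fmem_ground_point code_sep).
  exists v => //; left; apply: fmem_eql (feq_sym (feq_down (preorder_trans vu ur) ea)) _.
  by apply/generic_mem.
Qed.

(** * The Fubini square of the generic ultrafilter *)

Definition fiber R (s : S) : set S := [set t | R (s, t)].

Definition below_fubini R : formula P :=
  fun p => below [set s | below (fiber R s) p] p.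

Lemma below_fubini_down R : downward le (below_fubini R).
Proof.
by move=> p q qp /(below_down qp); apply: belowW => s /=; apply: below_down.
Qed.

Let GG : name P := ground_name (ground_set code2) below_fubini.

Lemma fubini_represents : represents le (ground_set code2) below_fubini GG.
Proof. exact: ground_name_represents below_fubini_down. Qed.

Lemma subset_of_prodE a p :
  subset_of_prod le a X X p <-> fsubset le a (nrel setT) p.
Proof.
split=> h x q qp xa.
  apply: (dense_belowE (regular_fmem _ _) (h x q qp xa)) => r rq [y].
  move=> /(dense_belowE (regular_fmem _ _)); apply=> u ur [z [yX [zX /is_pairE e]]].
  apply: (carrier_elim _ yX) => [|v s vu es]; first exact: regular_fmem.
  apply: (carrier_elim _ (fmem_down vu zX)) => [|w t wv et]; first exact: regular_fmem.
  apply/fmem_ground_set => w' w'w; exists w' => //; first exact: preorder_refl.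
  exists (s, t) => //; rewrite check_zpair.
  apply: feq_trans (feq_down _ e) (feq_pair (feq_down _ es) (feq_down w'w et)).
    exact: preorder_trans w'w (preorder_trans wv vu).
  exact: preorder_trans w'w wv.
have /fmem_ground_set := h x q qp xa; apply: dense_belowW => r _ [[s t] _ e].
exists (check P (code s)); apply: (fex_intro (x := check P (code t))).
  by do 2!(apply: regular_and; first exact: regular_fmem); apply: regular_pair.
do 2!(split; first exact: carrier_mem).
by apply/is_pairE; rewrite -check_zpair.
Qed.

Lemma fiber_generic a x R s p :
  feq le a (nrel R) p -> feq le x (check P (code s)) p ->
  class_in le (fun y => fand (fmem le y X) (pair_in le x y a)) G p <->
  below (fiber R s) p.
Proof.
move=> ea ex.
have mem t q : le q p ->
    pair_in le x (check P (code t)) a q <-> R (s, t).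
  move=> qp; apply: iff_trans (pair_inE _ _ _ _) _.
  have e : feq le (name_pair x (check P (code t))) (check P (code2 (s, t))) q.
    by rewrite check_zpair; apply: feq_pair (feq_refl _ _); apply: feq_down ex.
  have ea' : feq le a (nrel R) q by exact: feq_down ea.
  split=> h.
    apply/(fmem_ground_point code2_sep _ _ q); apply: fmem_eql e _.
    exact: fmem_eqr ea' h.
  apply: fmem_eql (feq_sym e) _; apply: fmem_eqr (feq_sym ea') _.
  by apply/(fmem_ground_point code2_sep).
split=> [h|pR].
  apply: (dense_belowE (below_regular _) h) => q qp [b [bG /is_classE bE]].
  apply: (generic_elim _ bG) => [|r E rq rE eb]; first exact: below_regular.
  apply: belowW rE => t Et.
  have tb : fmem le (check P (code t)) b r.
    by apply: fmem_eqr (feq_sym eb) _; apply/(fmem_ground_point code_sep).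
  have [_ /mem] := (bE _ _ rq).1 tb; apply.
  exact: preorder_trans rq qp.
apply: (fex_intro (x := nset (fiber R s))).
  apply: regular_and; first exact: regular_fmem.
  apply: regular_class => y; apply: regular_and; first exact: regular_fmem.
  exact: regular_ex.
split; first exact/generic_mem.
apply/is_classE => y q qp; split=> [yR|[yX yp]].
  apply: (nset_elim _ yR) => [|r t rq Rt et].
    by apply: regular_and; [apply: regular_fmem|apply: regular_ex].
  split; first by apply: fmem_eql (feq_sym et) _; apply: carrier_mem.
  apply/pair_inE.
  apply: fmem_eql (feq_pair (feq_refl x r) (feq_sym et)) _.
  by apply/pair_inE/mem => //; apply: preorder_trans rq qp.
apply: (carrier_elim _ yX) => [|r t rq et]; first exact: regular_fmem.
apply: fmem_eql (feq_sym et) _; apply/(fmem_ground_point code_sep).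
apply/(mem t r); first exact: preorder_trans rq qp.
apply/pair_inE; apply: fmem_eql (feq_pair (feq_refl x r) et) _.
apply/pair_inE; exact: (regular_ex _).1 rq yp.
Qed.

Lemma fiber_class_regular a x :
  regular le (class_in le (fun y => fand (fmem le y X) (pair_in le x y a)) G).
Proof. exact: regular_ex. Qed.

(** The set of s whose fiber is in G becomes a ground model set only when its membership has been
    decided, hence the [dense_below]. *)
Lemma fubini_generic a R p : feq le a (nrel R) p ->
  class_in le (fun x => fand (fmem le x X)
    (class_in le (fun y => fand (fmem le y X) (pair_in le x y a)) G)) G p <->
  dense_below le (below_fubini R) p.
Proof.
move=> ea; split=> [h|].
  apply: (dense_belowE (regular_dense _) h) => q qp [b [bG /is_classE bE]].
  apply: (generic_elim _ bG) => [|r E rq rE eb]; first exact: regular_dense.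
  apply: dense_belowI; first exact: below_fubini_down.
  have ea' : feq le a (nrel R) r by exact: feq_down (preorder_trans rq qp) ea.
  apply: belowW rE => s Es /=.
  apply/(fiber_generic ea' (feq_refl _ _)).
  have [//|_] := (bE (check P (code s)) r rq).1 _.
    by apply: fmem_eqr (feq_sym eb) _; apply/(fmem_ground_point code_sep).
  by [].
move=> h; apply: (dense_belowE (regular_ex _) h) => q qp Rq q0 q0q.
have [e e_inj] := carrier_enum.
(* Once r decides every fiber, the class of all s with fiber in G is the ground set of those s whose
   fiber r is below. *)
have [r rq0 dec] := dense_decide le_sigma e_inj
  (fun s => below_down (A := fiber R s)) (preorder_refl q0).
have rq : le r q by exact: preorder_trans rq0 q0q.
have Rr := below_fubini_down rq Rq.
exists r => //; exists (nset [set s | below (fiber R s) r]); split.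
  exact/generic_mem.
apply/is_classE => x u ur.
have ea' : feq le a (nrel R) u.
  by exact: feq_down (preorder_trans ur (preorder_trans rq qp)) ea.
split=> [xE|[xX xf]].
  apply: (nset_elim _ xE) => [|v s vu Es es].
    by apply: regular_and; [apply: regular_fmem|apply: fiber_class_regular].
  split; first by apply: fmem_eql (feq_sym es) _; apply: carrier_mem.
  apply/(fiber_generic (feq_down vu ea') es); apply: below_down Es.
  exact: preorder_trans vu ur.
apply: (carrier_elim _ xX) => [|v s vu es]; first exact: regular_fmem.
apply: fmem_eql (feq_sym es) _; apply/(fmem_ground_point code_sep).
have /(fiber_generic (feq_down vu ea') es) vR := (fiber_class_regular a x).1 _ _ vu xf.
by case: (dec s) => //= /(_ v (preorder_trans vu ur)).
Qed.

Lemma generic_fubini_product p : is_fubini_product le GG G X G X p.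
Proof.
apply/is_classE => a q qp; split=> [/fubini_represents h|[aX af]].
  apply: (dense_belowE _ h) => [|r _ [R Rr ea]].
    apply: regular_and; last exact: regular_ex.
    apply: regular_all => x.
    by apply: regular_imp; [apply: regular_fmem|apply: regular_ex].
  split.
    apply/subset_of_prodE; apply: fsubset_eq (feq_sym ea) (feq_refl _ _) _.
    exact/(fsubset_ground_set code2_sep).
  apply/(fubini_generic ea); apply: dense_belowI Rr; exact: below_fubini_down.
move/subset_of_prodE: aX => aX.
apply: (subset2_elim _ aX) => [|r R rq ea]; first exact: regular_fmem.
apply: (@dense_belowE _ _ _ (below_fubini R)) => [||u ur Ru].
- exact: regular_fmem.
- by apply/(fubini_generic ea); apply: (regular_ex _).1 rq af.
apply: fmem_eql (feq_sym (feq_down ur ea)) _.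
exact: represents_mem fubini_represents (@below_fubini_down R) Ru.
Qed.

(** * The two Tukey reductions *)

Lemma tukey_generic_le_fubini p :
  tukey_le le G (reverse_inclusion le) GG (reverse_inclusion le) p.
Proof.
apply: (ground_tukey code2_sep code_sep below_fubini_down below_down
  fubini_represents generic_represents
  (phi := fun R => [set s | exists t, R (s, t)])).
(* A fiber that q is below is nonempty, so s is in the domain of R. *)
- by move=> R q; apply: belowW => s /below_nonempty.
- move=> B q qB; exists q; first exact: preorder_refl.
  exists [set st | B st.1].
    by apply: belowW qB => s Bs; apply: below_sub => t _.
  by move=> R r _ _ RB s [t /RB].
Qed.

Definition two_above (layer : S -> nat) B (k m : nat) : Prop :=
  exists x y, [/\ B x, B y, layer y = m & k < layer x < m].

Lemma tukey_fubini_le_generic p :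
  tukey_le le GG (reverse_inclusion le) G (reverse_inclusion le) p.
Proof.
have [e e_inj] := carrier_enum.
have [layer [big hl]] := fin_power_layered hS.
have [J [J_mono J_ideal J_cof]] := fin_power_basis hS.
have next_ex (Bk : set S * nat) : exists m,
    (exists n, two_above layer Bk.1 Bk.2 n) ->
    two_above layer Bk.1 Bk.2 m /\ forall n, two_above layer Bk.1 Bk.2 n -> m <= n.
  have [[n Bn]|nB] := pselect (exists n, two_above layer Bk.1 Bk.2 n); last first.
    by exists 0 => /nB.
  have ex : exists n, `[< two_above layer Bk.1 Bk.2 n >].
    by exists n; apply/asboolP.
  case: (ex_minnP ex) => m /asboolP Bm min; exists m => _; split=> // i Bi.
  by apply: min; apply/asboolP.
have [next nextP] := choice next_ex.
have above B k : ~ ideal S B -> exists n, two_above layer B k n.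
  move=> Bpos; have /infinite_natP Binf : infinite_set (big B) by move/(ideal_big hl).
  have lay j : big B j -> exists2 x, B x & layer x = j.
    move=> Bj; apply: contrapT => nx; apply: (big0 hl (n := j)).
    by apply: (big_sub hl) Bj _ => x Bx xj; apply: nx; exists x.
  have [i /lay[x Bx xi] ki] := Binf k; have [j /lay[y By yj] ij] := Binf i.
  by exists j, x, y; split=> //; rewrite xi ki ij.
(* [next (B, k)] is the second and not the first layer of [B] above [k]: on a *)
(* thin [B] only the gaps between two layers are known to be large.           *)
pose h B s n := next (B, maxn (e s) n).
pose F B : set (S * S) := [set st | [/\ B st.1, B st.2 & ~ J (h B st.1) st.2]].
apply: (ground_tukey code_sep code2_sep below_down below_fubini_down
  generic_represents fubini_represents (phi := F)).
  (* For s in B, the fiber of [F B] is B minus a set of the ideal. *)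
  move=> B q qB; apply: belowW (qB) => s Bs /=.
  apply: (ideal_sub pS) (idealU pS qB (J_ideal (h B s))) => t [qt nF].
  have [Bt|nBt] := pselect (B t); [right|by left].
  by apply: contrapT => nJ; apply: nF.
move=> R q Rq.
have /choice [gg ggP] : forall i, exists g, forall s, e s = i ->
    below (fiber R s) q -> sval q `\` fiber R s `<=` J g.
  move=> i; have [[s si]|ns] := pselect (exists s, e s = i); last first.
    by exists id => s si; case: ns; exists s.
  have [sR|nsR] := pselect (below (fiber R s) q).
    by have [g sg] := J_cof _ sR; exists g => s'; rewrite -si => /e_inj ->.
  by exists id => s'; rewrite -si => /e_inj ->.
(* One function for all fibers: [g k] bounds [gg i n] whenever i, n <= k, which is why [h] looks
   above the maximum of [e s] and n. *)
pose g k := \max_(i < k.+1) \max_(n < k.+1) gg i n.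
have gP i n k : maxn i n <= k -> gg i n <= g k.
  rewrite geq_max => /andP[ik nk].
  apply: leq_trans (leq_bigmax (Ordinal (ik : i < k.+1))).
  exact: (leq_bigmax (Ordinal (nk : n < k.+1))).
(* B is chosen inside this set so that first coordinates have a controlled fiber and second
   coordinates lie in q. *)
have Qpos : ~ ideal S (sval q `&` [set s | below (fiber R s) q]).
  exact: below_pos (belowI (below_sub (@subset_refl _ _)) Rq).
have [B BQ [Bpos Bthin]] := fin_power_thin g hl Qpos.
pose r : P := exist (fun B => ~ ideal S B) B Bpos.
exists r; first by apply: (@below_sub _ r) => s /BQ[].
exists B; first exact: (@below_sub _ r).
move=> B' u ur uB' B'B [s t] [/= B's B't nJ].
have /BQ [_ sR] := B'B _ B's; have /BQ [qt _] := B'B _ B't.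
apply: contrapT => nR; apply: nJ.
apply: J_mono (ggP (e s) s erefl sR t (conj qt nR)) => n.
rewrite /h.
(* Two layers of [B'] above k are also layers of B, so the later one exceeds g of the earlier one,
   which is at least [gg (e s) n]. *)
have [[x [y [B'x B'y <- /andP[kx xy]]]] _] :=
  nextP (B', _) (above B' (maxn (e s) n) (below_pos uB')).
apply: ltnW; apply: leq_ltn_trans (Bthin x y (B'B _ B'x) (B'B _ B'y) xy).
by apply: gP; apply: ltnW.
Qed.
End Generic.

Theorem theorem3p9 (d : Order.disp_t) (W : orderType d)
    (hW : is_omega1 W)
    (L : W -> nat -> W) (L_ladder : ladder_system L)
    (alpha : W) (alpha_ge1 : ~ is_zero alpha) :
  let S : ideal_space := fin_power (omega1_wf hW) L alpha in
  let P : Type := positive_set S in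
  let le : P -> P -> Prop := @le_mod S in
  let X : name P := check P (code_set (@setT S)) in
  let G : name P := generic_filter S in
  forced
    (fand (is_ultrafilter le G X)
       (fex le (fun GG : name P =>
          fand (is_fubini_product le GG G X G X)
               (tukey_equiv le GG (reverse_inclusion le)
                               G (reverse_inclusion le))))).
Proof.
move=> S P le X G p.
have hS : fin_power_space S := fin_powerP (omega1_wf hW) L_ladder alpha_ge1.
split; first exact: generic_ultrafilter.
move=> q _; exists q; first exact: (le_mod_preorder hS).(preorder_refl).
exists (ground_name (ground_set (@code2 S)) (@below_fubini S)).
split; first exact: generic_fubini_product.
split; [exact: tukey_fubini_le_generic|exact: tukey_generic_le_fubini].
Qed.
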